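(* Let $M$ be a matroid on a finite ground set $E$ (loops allowed), and let $Y_M\subseteq(\mathbb{TP}^1)^E$ be its tropical matroid Schubert variety. For an admissible pair $(I,F)$ of $M$, let $U_{M(I,F)}$ be the support of the augmented Bergman fan $\Sigma^+_{M(I,F)}$, placed in the orbit $O(I,E\setminus F)\cong\mathbb{R}^{F\setminus I}$ of $(\mathbb{TP}^1)^E$. Then $Y_M$ admits a stratification by supports of augmented Bergman fans labelled by admissible pairs, $$Y_M=\coprod_{(I,F)\text{ admissible}}U_{M(I,F)},$$ and the partial order on admissible pairs induced by the stratification (that is, $(J,G)\preceq(I,F)$ when $U_{M(J,G)}$ is contained in the closure of $U_{M(I,F)}$) is given by $$(J,G)\preceq(I,F)\quad\text{if and only if}\quad I\subseteq J\text{ and }G\subseteq F.$$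
   Context: **Augmented Bergman fan and $Y_M$.** Let $(e_i)_{i\in E}$ be the standard basis of $\mathbb{R}^E$ and $e_S=\sum_{i\in S}e_i$. For $M$ loopless, a compatible pair $(I,\mathcal F)$ consists of an independent set $I$ and a (possibly empty) chain $\mathcal F$ of proper flats (flats $\neq E$) with $I\subseteq F$ for all $F\in\mathcal F$. The augmented Bergman fan $\Sigma_M^+$ is the simplicial fan in $\mathbb{R}^E$ with cones $\sigma_{I,\mathcal F}=\operatorname{cone}(e_i)_{i\in I}+\operatorname{cone}(-e_{E\setminus F})_{F\in\mathcal F}$, one for each compatible pair. If $M$ has set of loops $L$, $\Sigma^+_M$ is the image of $\Sigma^+_{M_L}$ under the inclusion $\mathbb{R}^{E\setminus L}\hookrightarrow\mathbb{R}^E$, where $M_L$ is the contraction of $M$ by $L$. Let $U_M=|\Sigma_M^+|$ be its support. Let $\mathbb{TP}^1=\mathbb{R}\cup\{-\infty,+\infty\}$ with the order topology. The tropical matroid Schubert variety $Y_M$ is the topological closure of $U_M\subseteq\mathbb{R}^E$ in $(\mathbb{TP}^1)^E$. **Orbits.** For disjoint $J,K\subseteq E$, $O(J,K)=\{x\in(\mathbb{TP}^1)^E:x_j=+\infty\ (j\in J),\ x_k=-\infty\ (k\in K),\ x_i\in\mathbb{R}\text{ otherwise}\}\cong\mathbb{R}^{E\setminus(J\sqcup K)}$. **Admissible pairs.** A pair $(I,F)$ is admissible if $I$ is an independent set of $M$, $F$ is a flat of $M$, and $I\subseteq F$. The minor $M(I,F)$ is the matroid on $F\setminus I$ obtained by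 restricting (localising) $M$ to $F$ and then contracting $I$; it may have loops. *)

(* Defs.v *)
From HB Require Import structures.
From mathcomp Require Import all_boot all_order all_algebra.

Set Implicit Arguments.
Unset Strict Implicit.
Unset Printing Implicit Defensive.

Local Open Scope set_scope.

(* The ground set is a subset of an ambient finite type, so that minors of a
   matroid on E live on the same type E. *)
Record matroid (E : finType) := Matroid {
  ground : {set E};
  indep : {set {set E}};
  indep_ground : forall I : {set E}, I \in indep -> I \subset ground;
  indep0 : set0 \in indep;
  indepS : forall I J : {set E}, J \subset I -> I \in indep -> J \in indep;
  indep_augment : forall I J : {set E},
    I \in indep -> J \in indep -> #|I| < #|J| ->
    exists2 x, x \in J :\: I & x |: I \in indep }.

Section MatroidTheory.
Variables (E : finType) (M : matroid E).
Implicit Types A B F I J : {set E}.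

Definition mrank A : nat := \max_(I in indep M | I \subset A) #|I|.

Definition is_basis A B : bool :=
  [&& B \in indep M, B \subset A & #|B| == mrank A].

Definition flat F : bool :=
  (F \subset ground M) &&
  [forall x in ground M :\: F, mrank F < mrank (x |: F)].

Definition loops : {set E} :=
  [set x in ground M | [set x] \notin indep M].

Lemma leq_mrank A I : I \in indep M -> I \subset A -> #|I| <= mrank A.
Proof.
move=> iI sIA; rewrite /mrank.
by apply: (leq_bigmax_cond (P := fun I => (I \in indep M) && (I \subset A)));
   rewrite iI sIA.
Qed.

Lemma basis_exists A : exists B, is_basis A B.
Proof.
have P0 : (set0 \in indep M) && (set0 \subset A).
  by rewrite (indep0 M) sub0set.
rewrite /is_basis /mrank (bigmax_eq_arg set0) //.
case: arg_maxnP => //= B /andP[iB sBA] _.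
by exists B; rewrite iB sBA eqxx.
Qed.

Definition restriction_indep F : {set {set E}} :=
  [set I in indep M | I \subset F].

Fact restriction_ground F I :
  I \in restriction_indep F -> I \subset ground M :&: F.
Proof. by rewrite inE subsetI => /andP[/indep_ground-> ->]. Qed.

Fact restriction_indep0 F : set0 \in restriction_indep F.
Proof. by rewrite inE (indep0 M) sub0set. Qed.

Fact restriction_indepS F I J : J \subset I ->
  I \in restriction_indep F -> J \in restriction_indep F.
Proof.
move=> sJI; rewrite !inE => /andP[iI sIF].
by rewrite (indepS sJI iI) (subset_trans sJI sIF).
Qed.

Fact restriction_augment F I J : I \in restriction_indep F ->
  J \in restriction_indep F -> #|I| < #|J| ->
  exists2 x, x \in J :\: I & x |: I \in restriction_indep F.
Proof.
rewrite !inE => /andP[iI sIF] /andP[iJ sJF] ltIJ.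
have [x xJI ixI] := indep_augment iI iJ ltIJ; exists x => //.
rewrite inE ixI subUset sub1set sIF andbT.
by apply: (subsetP sJF); case/setDP: xJI.
Qed.

Definition matroid_restrict F : matroid E :=
  Matroid (@restriction_ground F) (restriction_indep0 F)
    (@restriction_indepS F) (@restriction_augment F).

Definition contraction_indep A : {set {set E}} :=
  [set J : {set E} | (J \subset ground M :\: A) &&
           [exists B : {set E},
             is_basis (A :&: ground M) B && (J :|: B \in indep M)]].

Fact contraction_ground A J :
  J \in contraction_indep A -> J \subset ground M :\: A.
Proof. by rewrite inE => /andP[]. Qed.

Fact contraction_indep0 A : set0 \in contraction_indep A.
Proof.
rewrite inE sub0set /=; have [B bB] := basis_exists (A :&: ground M).
by apply/existsP; exists B; rewrite bB set0U; case/and3P: bB.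
Qed.

Fact contraction_indepS A I J : J \subset I ->
  I \in contraction_indep A -> J \in contraction_indep A.
Proof.
move=> sJI; rewrite !inE => /andP[sI /existsP[B /andP[bB iIB]]].
rewrite (subset_trans sJI sI); apply/existsP; exists B.
by rewrite bB (indepS _ iIB) // setSU.
Qed.

Fact contraction_augment A I J : I \in contraction_indep A ->
  J \in contraction_indep A -> #|I| < #|J| ->
  exists2 x, x \in J :\: I & x |: I \in contraction_indep A.
Proof.
rewrite !inE => /andP[sI /existsP[B /andP[bB iIB]]].
move=> /andP[sJ /existsP[C /andP[bC iJC]]] ltIJ.
have [[_ sBA /eqP cB] [_ sCA /eqP cC]] := (and3P bB, and3P bC).
have disj (K D : {set E}) :
    K \subset ground M :\: A -> D \subset A :&: ground M ->
    #|K :|: D| = #|K| + #|D|.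
  move=> sK sD; rewrite cardsU [K :&: D](_ : _ = set0) ?cards0 ?subn0 //.
  apply/setP=> y; rewrite !inE; apply/negP=> /andP[/(subsetP sK)].
  by rewrite inE => /andP[/negP nyA _] /(subsetP sD); rewrite inE => /andP[].
have lt : #|I :|: B| < #|J :|: C| by rewrite !disj // cB cC ltn_add2r.
have [x] := indep_augment iIB iJC lt.
rewrite !inE negb_or => /andP[/andP[nxI nxB] xJC] ixIB.
have nxA : x \notin A :&: ground M.
  apply/negP=> xA; have : #|x |: B| <= mrank (A :&: ground M).
    apply: leq_mrank; last by rewrite subUset sub1set xA.
    by apply: indepS ixIB; rewrite setUS // subsetUr.
  by rewrite cardsU1 nxB cB add1n ltnn.
have xJ : x \in J.
  by case/orP: xJC => // /(subsetP sCA); rewrite (negbTE nxA).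
exists x; first by rewrite inE nxI.
rewrite inE subUset sub1set sI (subsetP sJ) //=.
by apply/existsP; exists B; rewrite bB -setUA.
Qed.

Definition matroid_contract A : matroid E :=
  Matroid (@contraction_ground A) (contraction_indep0 A)
    (@contraction_indepS A) (@contraction_augment A).

Lemma loopless_contract_loops : loops = set0 ->
  ground (matroid_contract loops) = ground M /\
  indep (matroid_contract loops) = indep M.
Proof.
move=> ->; split; first exact: setD0.
apply/setP => J; rewrite inE setD0 set0I.
apply/andP/idP => [[_ /existsP[B /andP[_ iJB]]]|iJ].
  by apply: indepS iJB; exact: subsetUl.
split; first exact: indep_ground.
have [B bB] := basis_exists set0; apply/existsP; exists B; rewrite bB /=.
by case/and3P: bB => _; rewrite subset0 => /eqP-> _; rewrite setU0.
Qed.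

End MatroidTheory.

Definition minor (E : finType) (M : matroid E) (I F : {set E}) : matroid E :=
  matroid_contract (matroid_restrict M F) I.

(* [p] is the pair (I, F) *)
Definition admissible (E : finType) (M : matroid E) (p : {set E} * {set E}) :
    bool :=
  [&& p.1 \in indep M, flat M p.2 & p.1 \subset p.2].

From mathcomp Require Import all_classical all_reals all_analysis.
Import Order.TTheory GRing.Theory Num.Theory.
Import numFieldNormedType.Exports.

Local Open Scope classical_set_scope.
Local Open Scope ring_scope.

Section AugmentedBergmanFan.
Variables (R : realType) (E : finType).
Implicit Types (M : matroid E) (I F S : {set E}) (Fs : {set {set E}}).

(* For S : {set E}, the space R^S is identified with the space of vectors
   E -> R that vanish outside S. *)

Definition e_ S : E -> R := fun i => (i \in S)%:R.

Definition cone (T : finType) (A : {set T}) (v : T -> E -> R) : set (E -> R) :=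
  [set x | exists2 c : T -> R, (forall t, t \in A -> 0 <= c t)
                             & x = \sum_(t in A) c t *: v t].

Definition compatible M I Fs : Prop :=
  [/\ I \in indep M,
      (forall F, F \in Fs -> flat M F /\ F != ground M),
      (forall F G, F \in Fs -> G \in Fs -> (F \subset G) || (G \subset F))
    & (forall F, F \in Fs -> I \subset F)].

Definition sigma M I Fs : set (E -> R) :=
  [set x + y | x in cone I (fun i => e_ [set i]%SET)
             & y in cone Fs (fun F => - e_ (ground M :\: F)%SET)].

Definition loopless_aug_bergman_fan M : set (set (E -> R)) :=
  [set C | exists I Fs, compatible M I Fs /\ C = sigma M I Fs].

(* For loopless M the contraction is M itself (loopless_contract_loops). The
   inclusion of R^(ground M \ L) in R^(ground M) is extension by zero, hence the
   identity in this encoding. *)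
Definition aug_bergman_fan M : set (set (E -> R)) :=
  loopless_aug_bergman_fan (matroid_contract M (loops M)).

Definition aug_bergman_support M : set (E -> R) :=
  \bigcup_(C in aug_bergman_fan M) C.

End AugmentedBergmanFan.

Arguments e_ R {E} S i.
Arguments sigma R {E} M I Fs.
Arguments loopless_aug_bergman_fan R {E} M.
Arguments aug_bergman_fan R {E} M.
Arguments aug_bergman_support R {E} M.

(* (TP^1)^E with the product topology *)
Notation TP1 R E := {ptws E -> \bar R}.

Section SchubertVariety.
Variables (R : realType) (E : finType).
Implicit Types (M : matroid E) (I F J K : {set E}).

Definition tp_orbit J K : set (TP1 R E) :=
  [set x | forall i, if i \in J then x i = +oo%E
                     else if i \in K then x i = -oo%E
                     else x i \is a fin_num].

Definition orbit_point J K (u : E -> R) : TP1 R E :=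
  fun i => if i \in J then +oo%E else if i \in K then -oo%E else (u i)%:E.

(* orbit_point identifies R^(E \ (J u K)) with the orbit O(J, K). *)
Lemma orbit_point_bij J K :
  set_bij [set u | forall i, i \in J :|: K -> u i = 0] (tp_orbit J K)
    (orbit_point J K).
Proof.
split.
- move=> u _ i; rewrite /orbit_point.
  by case: (i \in J) => //; case: (i \in K).
- move=> u v; rewrite !inE /= => u0 v0 uv; apply/funext => i.
  have [iJK|] := boolP (i \in J :|: K); first by rewrite u0 ?v0.
  rewrite finset.in_setU negb_or => /andP[/negbTE iJ /negbTE iK].
  by have := congr1 (fun f => f i) uv; rewrite /orbit_point iJ iK => -[].
- move=> x xO; exists (fun i => fine (x i)).
    move=> i; rewrite finset.in_setU => iJK; move: (xO i) iJK.
    by case: (i \in J) => [-> //|]; case: (i \in K) => [-> |].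
  apply/funext => i; rewrite /orbit_point; move: (xO i).
  by case: (i \in J) => [-> //|]; case: (i \in K) => [-> //|/fineK].
Qed.

Definition schubert_variety M : set (TP1 R E) :=
  closure (orbit_point finset.set0 finset.set0 @` aug_bergman_support R M).

(* U_{M(I, F)} placed in the orbit O(I, E \ F), for p = (I, F) *)
Definition stratum M (p : {set E} * {set E}) : set (TP1 R E) :=
  orbit_point p.1 (~: p.2)%SET @` aug_bergman_support R (minor M p.1 p.2).

End SchubertVariety.

Arguments tp_orbit R {E} J K.
Arguments schubert_variety R {E} M.
Arguments stratum R {E} M p.

Definition locally_closed (X : topologicalType) (A : set X) : Prop :=
  exists U C : set X, [/\ open U, closed C & A = U `&` C].

Definition stratum_le (X : topologicalType) (P : Type) (S : P -> set X)
    (q p : P) : Prop :=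
  S q `<=` closure (S p).

(* A partition of Y into locally closed strata S p, for p in D, such that the
   closure of each stratum is a union of strata. *)
Definition stratification (X : topologicalType) (P : Type) (Y : set X)
    (D : set P) (S : P -> set X) : Prop :=
  [/\ Y = \bigcup_(p in D) S p,
      trivIset D S,
      forall p, D p -> locally_closed (S p)
    & forall p, D p ->
        closure (S p) = \bigcup_(q in [set q | D q /\ stratum_le S q p]) S q].

(* Main.v *)
Require Import Defs.
From mathcomp Require Import all_boot all_order all_algebra.
From mathcomp Require Import all_classical all_reals all_analysis.
From mathcomp Require Import lra.

(** The point of the proof is that all the strata are cut out of the product of
    extended lines by one condition, [schubert_vector M x]: the set of positive
    coordinates of [x] is independent, and for each [t <= 0] the set of
    coordinates that are at least [t] is a flat.

    For finite [x] this condition describes the support of the augmented Bergman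
    fan ([aug_bergman_supportP]). In a cone, the positive support lies in the
    independent set and each superlevel set is in the chain of flats or is the
    ground set; conversely, the positive part of [x] and the layers of its
    negative part ([layer_cake]) recover a cone. For [x] with infinite
    coordinates, exactly [+oo] on [I] and [-oo] off [F], the condition for [M]
    amounts to the condition for the minor [minor M I F] on the finite
    coordinates ([stratumP]). So the stratum of [(I, F)] consists of the vectors
    with the condition that lie in the orbit of [I] and the complement of [F],
    and for a vector with the condition the pair read off its infinite
    coordinates is always admissible ([schubert_vector_stratum]).

    The condition is a finite conjunction of finite disjunctions of weak
    inequalities between coordinates, hence closed, and it is stable under
    truncation of the coordinates in [F :\: I] to [[-n, n]]. Therefore the
    closure of the stratum of [(I, F)] consists of the vectors with the
    condition that are [+oo] on [I] and [-oo] off [F] ([closure_stratum]). With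
    [I] empty and [F] the ground set this computes the Schubert variety
    ([schubert_varietyE]); in general it shows that the closure is the union of
    the strata of the pairs [(J, G)] with [I] inside [J] and [G] inside [F].
    Strata are locally closed, as finiteness of a coordinate is an open
    condition. *)

Set Implicit Arguments.
Unset Strict Implicit.
Unset Printing Implicit Defensive.

(** * Flats, contractions and minors of matroids *)

Section MatroidLemmas.
Import mathcomp.boot.fintype mathcomp.boot.finset.
Local Open Scope nat_scope.
Local Open Scope set_scope.
Variables (E : finType) (M : matroid E).
Implicit Types (A B F I J K : {set E}) (i : E).

Lemma extend_to_basis A I : I \in indep M -> I \subset A ->
  exists2 B, is_basis M A B & I \subset B.
Proof.
move=> iI sIA.
pose P B := [&& B \in indep M, I \subset B & B \subset A].
have PI : P I by rewrite /P iI subxx sIA.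
case: (arg_maxnP (fun B => #|B|) PI) => B /and3P[iB sIB sBA] maxB.
exists B => //; rewrite /is_basis iB sBA /= eqn_leq leq_mrank //=.
rewrite leqNgt; apply/negP => ltB.
have [C /and3P[iC sCA /eqP cC]] := basis_exists M A; rewrite -cC in ltB.
have [x /setDP[xC xB] ixB] := indep_augment iB iC ltB.
have := maxB (x |: B); rewrite /P ixB !subUset sub1set sBA (subsetP sCA) //=.
by rewrite (subset_trans sIB) ?subsetUr // cardsU1 xB ltnn => /(_ isT).
Qed.

(** If [i] raises the rank of [A], then a basis of [i |: A] extending [K] must
    use [i], since a basis inside [A] would be too small. *)
Lemma rank_jump A K i : mrank M A < mrank M (i |: A) -> K \in indep M ->
  K \subset A -> i |: K \in indep M.
Proof.
move=> ltA iK sKA.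
have [B /and3P[iB sB /eqP cB] sKB] :=
  extend_to_basis iK (subset_trans sKA (subsetUr [set i] A)).
apply: (indepS _ iB); rewrite subUset sKB andbT sub1set.
apply: contraLR ltA => iNB; rewrite -leqNgt -cB leq_mrank //.
apply/subsetP => j jB; have := subsetP sB j jB; rewrite !inE.
by case: eqP jB => // ->; rewrite (negbTE iNB).
Qed.

(** A description of flats by independent sets instead of ranks. It depends on
    the ground set and the family of independent sets only, so it transfers to
    contractions, whose independent sets are known. *)
Lemma flatP F : flat M F <->
  F \subset ground M /\ forall i K, i \in ground M -> i \notin F ->
    K \in indep M -> K \subset F -> i |: K \in indep M.
Proof.
rewrite /flat; split=> [/andP[-> /forall_inP jump]|[-> ext]].
  split=> // i K ig iF iK sKF; apply: rank_jump iK sKF.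
  by apply: jump; rewrite inE iF.
apply/forall_inP => i /setDP[ig iF].
have [B /and3P[iB sBF /eqP <-]] := basis_exists M F.
have iNB : i \notin B by apply: contra iF; exact: subsetP.
have -> : (#|B| < mrank M (i |: F)) = (#|i |: B| <= mrank M (i |: F)).
  by rewrite cardsU1 iNB.
by apply: leq_mrank; [exact: ext|exact: setUS].
Qed.

(** A dependency of [i] on [K] is also witnessed by an independent set that
    contains [I]: a basis of [I :|: K] through [I] spans [K], hence [i]. This
    turns a dependency in a matroid into one in its contraction by [I]. *)
Lemma dependent_over I K i : I \in indep M -> K \in indep M -> i \notin I ->
  i |: K \notin indep M ->
  exists B, [/\ I \subset B, B \subset I :|: K, B \in indep M &
                i |: B \notin indep M].
Proof.
move=> iI iK niI dep.
have [B /and3P[iB sB /eqP cB] sIB] := extend_to_basis iI (subsetUl I K).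
exists B; split=> //; apply: contra dep => ind.
have [iinK|niK] := boolP (i \in K).
  by rewrite (setUidPr _) // sub1set.
apply: (rank_jump (A := I :|: K)) iK (subsetUr _ _); rewrite -cB.
have niB : i \notin B.
  by apply/negP => /(subsetP sB); rewrite inE (negbTE niI) (negbTE niK).
apply: (@leq_trans #|i |: B|); first by rewrite cardsU1 niB.
by apply: leq_mrank => //; exact: setUS.
Qed.

Lemma indep_contract A J : A \in indep M ->
  (J \in indep (matroid_contract M A)) =
    (J \subset ground M :\: A) && (J :|: A \in indep M).
Proof.
move=> iA; rewrite inE; congr (_ && _).
have sAg := indep_ground iA; have -> : A :&: ground M = A by apply/setIidPl.
apply/existsP/idP => [[B /andP[bB]]|iJA].
  suff -> : B = A by [].
  case/and3P: bB => _ sBA /eqP cB; apply/eqP.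
  by rewrite eqEcard sBA cB leq_mrank.
exists A; rewrite iJA andbT /is_basis iA subxx eqn_leq leq_mrank //=.
by apply/bigmax_leqP => K /andP[_]; exact: subset_leq_card.
Qed.

Lemma loopN i K : i \in loops M -> K \in indep M -> i \notin K.
Proof.
rewrite inE => /andP[_ iN] iK; apply: contra iN => iinK.
by apply: indepS iK; rewrite sub1set.
Qed.

(** The loops have the empty set as their only basis, so their contraction
    removes them from the ground set and changes nothing else. *)
Lemma indep_contract_loops : indep (matroid_contract M (loops M)) = indep M.
Proof.
apply/setP => J; rewrite inE; apply/andP/idP => [[_ /existsP[B /andP[_]]]|iJ].
  by apply: indepS; exact: subsetUl.
split.
  apply/subsetP => i iinJ; rewrite inE (subsetP (indep_ground iJ)) // andbT.
  by apply: contraL iJ => /loopN iN; apply: contraL iinJ; exact: iN.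
have [B bB] := basis_exists M (loops M :&: ground M).
apply/existsP; exists B; rewrite bB; case/and3P: bB => iB sB _ /=.
suff -> : B = set0 by rewrite setU0.
apply/setP => i; rewrite inE; apply/negP => iinB.
have /setIP[/loopN/(_ iB)] := subsetP sB i iinB.
by rewrite iinB.
Qed.

End MatroidLemmas.

Section Minor.
Import mathcomp.boot.fintype mathcomp.boot.finset.
Local Open Scope set_scope.
Variables (E : finType) (M : matroid E).
Implicit Types (I F J : {set E}).

Lemma ground_minor I F : ground (minor M I F) = (ground M :&: F) :\: I.
Proof. by []. Qed.

Lemma indep_minor I F J : I \in indep M -> I \subset F ->
  (J \in indep (minor M I F)) = (J \subset F :\: I) && (J :|: I \in indep M).
Proof.
move=> iI sIF; rewrite indep_contract /=; last by rewrite inE iI.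
rewrite inE subUset sIF andbT; apply/idP/idP.
  case/and3P=> sJ iJI sJF; rewrite iJI andbT.
  by apply: subset_trans sJ _; rewrite setSD // subsetIr.
case/andP=> sJ iJI; rewrite iJI (subset_trans sJ (subsetDl _ _)) !andbT /=.
apply/subsetP => j jJ; have /setDP[jF jI] := subsetP sJ j jJ.
rewrite !inE jI jF andbT (subsetP (indep_ground iJI)) //.
by rewrite inE jJ.
Qed.

End Minor.

(** * The support of the augmented Bergman fan *)

(** This says that the positive support of [x] is independent and that the
    superlevel sets [t <= x i] in the ground set, for [t <= 0], are flats. The
    second condition is stated without thresholds: [x i] is nonnegative or at
    least the minimum of [x] over every independent [K] that spans [i]. In this
    form it is a finite conjunction of finite disjunctions of weak inequalities
    between coordinates, which makes closedness visible. *)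
Definition schubert_vector (R : realType) (E : finType) (M : matroid E)
    (x : E -> \bar R) : Prop :=
  [set i | (0 < x i)%E]%SET \in indep M /\
  forall i (K : {set E}), i \in ground M -> K \in indep M ->
    (i |: K)%SET \notin indep M ->
    (0 <= x i)%E \/ exists2 j, j \in K & (x j <= x i)%E.

Section FanSupport.
Import mathcomp.boot.fintype mathcomp.boot.finset.
Import Order.TTheory GRing.Theory Num.Theory.
Local Open Scope set_scope.
Local Open Scope ring_scope.
Variables (R : realType) (E : finType).
Implicit Types (M : matroid E) (g F I J K : {set E}) (u : E -> R).

(** A nonpositive vector on [g] is a nonnegative combination of the
    [- e_ (g :\: F)], for [F] ranging over its proper superlevel sets. The
    largest negative value [a] is peeled off first: adding [- a] on the negative
    support shifts the remaining superlevel sets and enlarges the zero set. *)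
Lemma layer_cake g u :
  (forall i, u i <= 0) -> (forall i, i \notin g -> u i = 0) ->
  exists (Fs : {set {set E}}) (c : {set E} -> R),
  [/\ forall F, F \in Fs -> exists i t,
        [/\ i \in g, u i < t, t <= 0 & F = [set j in g | t <= u j]],
      forall F, F \in Fs -> 0 <= c F
    & forall i, u i = - \sum_(F in Fs) c F * (i \in g :\: F)%:R].
Proof.
move: {2}#|_| (leqnn #|[set i | u i < 0]|) => n.
elim: n u => [|n IHn] u.
  rewrite leqn0 cards_eq0 => /eqP neg0 u_le0 _.
  exists set0, (fun=> 0); split=> [F|F|i]; rewrite ?inE // big_set0 oppr0.
  apply/eqP; rewrite eq_le u_le0 leNgt; apply/negP => ui.
  by have := in_set0 i; rewrite -neg0 inE ui.
move=> le_n u_le0 u0.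
have [neg0|] := set_0Vmem [set i | u i < 0].
  by apply: IHn => //; rewrite neg0 cards0.
case=> i1; rewrite inE => neg1.
case: (@Order.TotalTheory.arg_maxP _ _ _ i1 (fun i => u i < 0) u neg1).
move=> i0 neg0 max0; set a := u i0 in neg0 max0.
pose u' i := if u i < 0 then u i - a else u i.
have u'_le0 i : u' i <= 0.
  by rewrite /u'; case: ifP => // /max0; rewrite subr_le0.
have neg_g i : u i < 0 -> i \in g.
  by apply: contraLR => /u0->; rewrite ltxx.
have u'0 i : i \notin g -> u' i = 0.
  by move=> /u0 ui; rewrite /u' ui ltxx.
have lt_n : (#|[set i | (u' i < 0)%R]| <= n)%N.
  rewrite -ltnS; apply: leq_trans le_n; apply: proper_card.
  apply/properP; split; last first.
    by exists i0; rewrite !inE // /u' neg0 subrr ltxx.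
  by apply/subsetP => i; rewrite !inE /u'; case: ifP => // ->.
have [Fs [c [levelFs c_ge0 u'E]]] := IHn u' lt_n u'_le0 u'0.
pose F0 := [set j in g | 0 <= u j].
(* The members of [Fs] contain [i0], where [u'] vanishes, and [F0] does not. *)
have F0Fs : F0 \notin Fs.
  apply/negP => /levelFs[i [t [_ _ t_le0]]] /setP/(_ i0).
  by rewrite !inE neg_g // leNgt neg0 /u' neg0 subrr t_le0.
exists (F0 |: Fs), (fun F => if F == F0 then - a else c F); split.
- move=> F; rewrite !inE => /orP[/eqP->|/levelFs[i [t [ig ut t_le0 ->]]]].
    by exists i0, 0; rewrite neg_g //; split.
  have neg_i : u i < 0.
    rewrite ltNge; apply/negP => ui; move: ut.
    rewrite /u' [u i < 0]ltNge ui /= => /lt_le_trans/(_ t_le0).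
    by rewrite ltNge ui.
  exists i, (t + a); split=> //.
  + by move: ut; rewrite /u' neg_i; lra.
  + by move: t_le0 neg0; lra.
  + apply/setP => j; rewrite !inE; congr (_ && _); rewrite /u'.
    case: ltP => uj; first by rewrite lerBrDr.
    by rewrite (le_trans t_le0 uj) (le_trans _ uj) //; move: t_le0 neg0; lra.
- move=> F; rewrite !inE; case: eqP => /= [_ _|_ /c_ge0 //].
  by rewrite oppr_ge0 ltW.
- move=> i; rewrite big_setU1 //= eqxx.
  have -> : \sum_(F in Fs) (if F == F0 then - a else c F) * (i \in g :\: F)%:R
         = - u' i.
    rewrite u'E opprK; apply: eq_bigr => F FFs.
    by case: eqP FFs => // ->; rewrite (negbTE F0Fs).
  rewrite !inE negb_and -ltNge /u'.
  case: (boolP (i \in g)) => ig /=; last first.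
    by rewrite u0 // ltxx mulr0; lra.
  by case: (u i < 0) => /=; lra.
Qed.

Lemma cone_basisE I (a : E -> R) i :
  (\sum_(t in I) a t *: (e_ R [set t] : E -> R)) i = if i \in I then a i else 0.
Proof.
rewrite fct_sumE; case: ifP => iI.
  rewrite (bigD1 i) //= big1 ?addr0.
    by rewrite /e_ fctE inE eqxx [LHS]mulr1.
  by move=> j /andP[_ ji]; rewrite /e_ fctE inE eq_sym (negbTE ji) scaler0.
apply: big1 => j jI; rewrite /e_ fctE inE; case: eqP => [ij|_].
  by rewrite ij jI in iI.
by rewrite scaler0.
Qed.

Lemma cone_flatsE g (Fs : {set {set E}}) (c : {set E} -> R) i :
  (\sum_(F in Fs) c F *: (- e_ R (g :\: F) : E -> R)) i =
  - \sum_(F in Fs) c F * (i \in g :\: F)%:R.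
Proof.
rewrite fct_sumE -sumrN; apply: eq_bigr => F _.
by rewrite /e_ !fctE -mulrN.
Qed.

(** On a cone of the chain [Fs], the value at [k] outside [I] is minus the total
    weight of the flats that miss [k]. If some flat misses [i], the largest such
    flat [F] is missed by some [j] in [K], as [K] spans [i]; by the chain
    condition every flat missing [i] lies in [F], so it misses [j] too. *)
Lemma sigma_sub M I Fs u : compatible M I Fs -> sigma R M I Fs u ->
  (forall i, i \notin ground M -> u i = 0) /\
  schubert_vector M (fun i => (u i)%:E).
Proof.
move=> [iI flFs chFs IFs] [x [a a_ge0 xE] [y [c c_ge0 yE] <-]].
set g := ground M in yE *.
have Ig : I \subset g := indep_ground iI.
pose cost k := \sum_(F in Fs) c F * (k \in g :\: F)%:R.
have uE k : (x + y) k = (if k \in I then a k else 0) - cost k.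
  by rewrite fctE xE yE cone_basisE cone_flatsE.
have cost_ge0 k : 0 <= cost k.
  by apply: sumr_ge0 => F /c_ge0 cF; rewrite mulr_ge0.
split.
  move=> i ig; rewrite uE (negbTE (contra (subsetP Ig i) ig)).
  by rewrite /cost big1 ?subrr // => F _; rewrite inE (negbTE ig) andbF mulr0.
split.
  apply: indepS iI; apply/subsetP => i; rewrite inE lte_fin uE.
  case: (i \in I) => //; move: (cost_ge0 i); lra.
move=> i K ig iK dep; case: (pickP [pred F | (F \in Fs) && (i \notin F)]).
  move=> F1 PF1; right.
  case: (arg_maxnP (fun F : {set E} => #|F|) PF1) => F /andP[FFs iF] maxF.
  have [[/flatP[_ extF] _] IF] := (flFs F FFs, IFs F FFs).
  have /subsetPn[j jK jF] : ~~ (K \subset F).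
    by apply: contra dep => sKF; exact: extF.
  exists j => //; rewrite lee_fin !uE.
  rewrite (negbTE (contra (subsetP IF j) jF)).
  rewrite (negbTE (contra (subsetP IF i) iF)).
  rewrite !sub0r lerN2; apply: ler_sum => G GFs.
  apply: ler_wpM2l; first exact: c_ge0.
  rewrite !inE ig (subsetP (indep_ground iK)) // !andbT ler_nat.
  case: (boolP (i \in G)) => //= iG; suff -> : j \notin G by [].
  case/orP: (chFs F G FFs GFs) => sFG; last first.
    by apply: contra jF; exact: subsetP.
  have le_GF : (#|G| <= #|F|)%N by apply: maxF; rewrite /= GFs.
  by have /eqP<- : F == G by rewrite eqEcard sFG.
move=> iFs; left; rewrite lee_fin uE.
have -> : cost i = 0.
  apply: big1 => F FFs; move: (iFs F); rewrite /= FFs /= => /negbFE iF.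
  by rewrite inE iF mulr0.
by case: ifP => [/a_ge0|]; lra.
Qed.

(** Conversely the positive part of [u] gives the cone over an independent set
    and the negative part gives, by [layer_cake], the cone over a chain of
    superlevel sets, which are flats. *)
Lemma sub_sigma M u : (forall i, i \notin ground M -> u i = 0) ->
  schubert_vector M (fun i => (u i)%:E) ->
  exists I Fs, compatible M I Fs /\ sigma R M I Fs u.
Proof.
move=> u0 [iI cmp]; set g := ground M in u0 cmp *.
set I := [set i | _] in iI.
pose v i := Num.min (u i) 0.
have v_le0 i : v i <= 0 by rewrite ge_min lexx orbT.
have v0 i : i \notin g -> v i = 0 by move=> /u0 ui; rewrite /v ui minxx.
have vle t i : t <= 0 -> (t <= v i) = (t <= u i).
  by move=> t_le0; rewrite le_min t_le0 andbT.
have [Fs [c [levelFs c_ge0 vE]]] := layer_cake v_le0 v0.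
exists I, Fs; split.
  split=> //.
  - move=> F /levelFs[i [t [ig vt t_le0 ->]]]; split; last first.
      apply/eqP => /setP/(_ i); rewrite inE ig /=.
      by rewrite leNgt vt.
    apply/flatP; split; first by apply/subsetP => j; rewrite inE => /andP[].
    move=> j K jg; rewrite inE jg /= vle // -ltNge => ujt iK sK.
    apply: contraT => dep; case: (cmp j K jg iK dep).
      by rewrite lee_fin => /le_lt_trans/(_ ujt); rewrite ltNge t_le0.
    move=> [k /(subsetP sK)]; rewrite inE vle // => /andP[_ tk].
    by rewrite lee_fin leNgt (lt_le_trans ujt tk).
  - move=> F G /levelFs[_ [t [_ _ _ ->]]] /levelFs[_ [s [_ _ _ ->]]].
    case/orP: (le_total t s) => ts; apply/orP; [right|left];
      by apply/subsetP => j; rewrite !inE => /andP[-> /(le_trans ts)].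
  - move=> F /levelFs[i [t [_ _ t_le0 ->]]]; apply/subsetP => j.
    move=> jI; rewrite inE vle // (subsetP (indep_ground iI)) //=.
    by move: jI; rewrite inE lte_fin => /ltW; exact: le_trans.
exists (\sum_(t in I) u t *: (e_ R [set t] : E -> R)).
  by exists u => // t; rewrite inE lte_fin => /ltW.
exists (\sum_(F in Fs) c F *: (- e_ R (g :\: F) : E -> R)); first by exists c.
apply/funext => i; rewrite fctE cone_basisE cone_flatsE -vE inE lte_fin /v.
by case: ltP => ui; lra.
Qed.

(** Contracting the loops does not affect the condition on [u]: a loop is not in
    the positive support, and it depends on the empty set, so [u] vanishes on
    the loops anyway. *)
Lemma aug_bergman_supportP M u : aug_bergman_support R M u <->
  (forall i, i \notin ground M -> u i = 0) /\
  schubert_vector M (fun i => (u i)%:E).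
Proof.
have iE := indep_contract_loops M.
have gE : ground (matroid_contract M (loops M)) = ground M :\: loops M by [].
split.
  move=> [C [I [Fs [comp ->]]] Cu]; have [] := sigma_sub comp Cu.
  rewrite gE => u0 [iI cmp]; rewrite iE in iI cmp.
  split; first by move=> i ig; apply: u0; rewrite inE (negbTE ig) andbF.
  split=> // i K ig iK dep; have [il|iNl] := boolP (i \in loops M).
    by left; rewrite lee_fin u0 // inE il.
  by apply: cmp => //; rewrite gE inE iNl.
move=> [u0 [iI cmp]].
have [I [Fs [comp Cu]]] : exists I Fs,
    compatible (matroid_contract M (loops M)) I Fs /\
    sigma R (matroid_contract M (loops M)) I Fs u.
  apply: sub_sigma; last first.
    by split; rewrite iE // => i K; rewrite gE => /setDP[ig _]; exact: cmp.
  move=> i; rewrite gE inE negb_and negbK => /orP[il|]; last exact: u0.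
  apply/eqP; rewrite eq_le; apply/andP; split.
    by move: (loopN il iI); rewrite inE lte_fin -leNgt.
  move: (il); rewrite inE => /andP[ig idep].
  have := cmp i set0 ig (indep0 M); rewrite setU0 lee_fin => /(_ idep)[//|[j]].
  by rewrite inE.
by exists (sigma R (matroid_contract M (loops M)) I Fs) => //; exists I, Fs.
Qed.

End FanSupport.

(** * Closed conditions and truncation in the product of extended lines *)

Section ProductTopology.
Import Order.TTheory GRing.Theory Num.Theory numFieldNormedType.Exports.
Local Open Scope classical_set_scope.
Local Open Scope ereal_scope.
Variables (R : realType) (E : finType).

Lemma ptws_coord_continuous i : continuous (fun x : TP1 R E => x i).
Proof. exact: (@proj_continuous E (fun=> \bar R) i). Qed.

Lemma ptws_cvg (F : set_system (TP1 R E)) (x : TP1 R E) : Filter F ->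
  (forall i, (y i @[y --> F]) --> x i) -> F --> x.
Proof.
move=> FF cvF; apply/cvg_sup => i; apply/cvg_image.
  by rewrite eqEsubset; split=> // a _; exists (fun=> a).
move=> W /cvF FW; exists ((fun y : TP1 R E => y i) @^-1` W) => //.
by rewrite eqEsubset; split=> [a [y Wy <-]//|a Wa]; exists (fun=> a).
Qed.

Lemma closed_coord_le i j : closed [set x : TP1 R E | x i <= x j].
Proof.
move=> x clx; set A := [set y | _] in clx.
have PF : ProperFilter (within A (nbhs x)) by exact: within_nbhs_proper.
have cvg_coord k : (y k @[y --> within A (nbhs x)]) --> x k.
  by apply: cvg_trans (@ptws_coord_continuous k x); exact/cvg_app/cvg_within.
have limE k : lim (y k @[y --> within A (nbhs x)]) = x k.
  exact/cvg_lim/cvg_coord.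
rewrite /= -(limE i) -(limE j); apply: lee_lim.
- by apply/cvg_ex; exists (x i).
- by apply/cvg_ex; exists (x j).
- exact: withinT.
Qed.

Lemma closed_coord_ge i a : closed [set x : TP1 R E | a <= x i].
Proof.
have /continuous_closedP := @ptws_coord_continuous i.
by move=> /(_ _ (@closed_ereal_le_ereal R a)).
Qed.

Lemma closed_coord_le_cst i a : closed [set x : TP1 R E | x i <= a].
Proof.
have /continuous_closedP := @ptws_coord_continuous i.
by move=> /(_ _ (@closed_ereal_ge_ereal R a)).
Qed.

Lemma closed_exists_in (K : {set E}) (A : E -> set (TP1 R E)) :
  (forall i, closed (A i)) -> closed [set x | exists2 i, i \in K & A i x].
Proof.
move=> clA; have -> : [set x | exists2 i, i \in K & A i x] =
    \bigcup_(i in [set` K]) A i by [].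
by apply: closed_bigcup => // i _; exact: clA.
Qed.

(** A violated condition would be a finite disjunction of weak inequalities that
    holds on the whole set, hence on its closure. *)
Lemma closed_schubert_vector (M : matroid E) :
  closed [set x : TP1 R E | schubert_vector M x].
Proof.
move=> x clx; set A := [set y | _] in clx.
have closedP (B : set (TP1 R E)) : closed B -> A `<=` B -> B x.
  by move=> clB /closureS /(_ x clx); exact: clB.
split.
  apply: contraT => dep.
  set D := [set i | _]%SET in dep.
  have [|y [iy _]|i] :=
      closedP [set x : TP1 R E | exists2 i, i \in D & x i <= 0].
  - apply: (@closed_exists_in D (fun i => [set x : TP1 R E | x i <= 0])) => i.
    exact: closed_coord_le_cst.
  - apply: contrapT => nex; move: dep; rewrite (indepS _ iy) //.
    apply/fintype.subsetP => i iD; rewrite finset.inE ltNge.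
    by apply/negP => yi; apply: nex; exists i.
  - by rewrite finset.inE leNgt => ->.
move=> i K ig iK dep.
apply: (closedP ([set x | 0 <= x i] `|`
                 [set x | exists2 j, j \in K & x j <= x i])).
  apply: closedU; first exact: closed_coord_ge.
  apply: (@closed_exists_in K (fun j => [set x : TP1 R E | x j <= x i])) => j.
  exact: closed_coord_le.
by move=> y [_ cmp]; exact: cmp.
Qed.

Definition clamp (n : nat) (x : \bar R) : \bar R :=
  Order.max (- n%:R)%:E (Order.min n%:R%:E x).

Lemma clamp_fin_num n x : clamp n x \is a fin_num.
Proof.
rewrite /clamp; case: x => [r||].
- by rewrite -EFin_min -EFin_max.
- by rewrite minEle leey -EFin_max.
- by rewrite minEle leeNy_eq /= maxEle leeNy_eq.
Qed.

Lemma clamp_le n x y : x <= y -> clamp n x <= clamp n y.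
Proof. by move=> xy; rewrite /clamp le_max2 // le_min2. Qed.

Lemma clamp_gt0 n x : (0 < clamp n.+1 x) = (0 < x).
Proof.
by rewrite /clamp lt_max lt_min !lte_fin oppr_gt0 ltrn0 ltr0n.
Qed.

Lemma clamp_ge0 n x : 0 <= x -> 0 <= clamp n x.
Proof. by move=> x0; rewrite /clamp le_max le_min x0 !lee_fin ler0n orbT. Qed.

(** The index is shifted because [clamp 0] is constant: only from 1 on does the
    truncation preserve signs, see [clamp_gt0]. *)
Lemma cvg_clamp x : clamp n.+1 x @[n --> \oo] --> x.
Proof.
suff : clamp ^~ x @ \oo --> x by rewrite -cvg_shiftS.
case: x => [r||].
- apply: cvg_near_cst; near=> n; rewrite /clamp.
  have rn : (`|r| <= n%:R)%R by near: n; exact: nbhs_infty_ger.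
  move: rn; rewrite ler_norml => /andP[nr rn].
  by rewrite min_r ?lee_fin // max_r ?lee_fin.
- have -> : clamp ^~ +oo = (fun n => n%:R%:E).
    apply/funext => n; rewrite /clamp min_l ?leey // max_r // lee_fin.
    by rewrite ge0_cp.
  exact/cvgeryP/cvgr_idn.
- have -> : clamp ^~ -oo = (fun n => (- n%:R)%:E).
    by apply/funext => n; rewrite /clamp min_r ?leNye // max_l // leNye.
  by apply/cvgerNyP; move/cvgNrNy: (@cvgr_idn R).
Unshelve. all: by end_near. Qed.

End ProductTopology.

(** * Strata and their closures *)

Section Strata.
Import mathcomp.boot.fintype mathcomp.boot.finset.
Import Order.TTheory GRing.Theory Num.Theory numFieldNormedType.Exports.
Local Open Scope set_scope.
Local Open Scope ereal_scope.
Variables (R : realType) (E : finType) (M : matroid E).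
Variable (groundM : ground M = [set: E]%SET).
Implicit Types (I F J G K : {set E}) (x y : TP1 R E).

(** The condition defining the support of the fan of the minor, for the finite
    coordinates, is the same condition for the whole vector and [M]. An
    independent set of the minor is one of [M] with [I] removed, and the
    coordinates in [I], being [+oo], never realize a minimum. Outside the flat
    [F] nothing is required: an independent set that spans an element outside
    [F] leaves [F] itself, where the coordinates are [-oo]. *)
Lemma stratumP I F x : admissible M (I, F) ->
  stratum R M (I, F) x <-> schubert_vector M x /\ tp_orbit R I (~: F)%SET x.
Proof.
case/and3P=> /= iI /flatP[_ extF] sIF.
have gE : ground (minor M I F) = F :\: I by rewrite ground_minor groundM setTI.
split.
  move=> [u /aug_bergman_supportP []]; rewrite gE => u0 [iu cmp] <-.
  set y : TP1 R E := orbit_point I (~: F) u.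
  have yI i : i \in I -> y i = +oo by rewrite /y /orbit_point => ->.
  have yNF i : i \notin F -> y i = -oo.
    move=> iF; rewrite /y /orbit_point inE iF.
    by rewrite (negbTE (contra (subsetP sIF i) iF)).
  have yu i : i \in F -> i \notin I -> y i = (u i)%:E.
    by move=> iF iNI; rewrite /y /orbit_point inE iF (negbTE iNI).
  split; last first.
    move=> i; rewrite /y /orbit_point; case: (i \in I) => //=.
    by case: (i \in ~: F).
  split.
    have : [set i | 0 < (u i)%:E] :|: I \in indep M.
      by move: iu; rewrite indep_minor // => /andP[].
    apply: indepS; apply/subsetP => i; rewrite !inE.
    have [//|iI'] := boolP (i \in I); first by rewrite orbT.
    have [iF|/yNF->] := boolP (i \in F); last by [].
    by rewrite yu // orbF.
  move=> i K ig iK dep.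
  have [iNF|iF] := boolP (i \notin F).
    have /subsetPn[j jK jF] : ~~ (K \subset F).
      by apply: contra dep => sKF; exact: extF.
    by right; exists j => //; rewrite yNF // leNye.
  rewrite negbK in iF.
  have [sKF|/subsetPn[j jK /yNF yj]] := boolP (K \subset F).
    have [/yI->|iNI] := boolP (i \in I); first by left; rewrite leey.
    (* [K] need not contain [I]; only supersets of [I] are seen by the minor. *)
    have [B [sIB sBIK iB depB]] := dependent_over iI iK iNI dep.
    have BE : B :\: I :|: I = B.
      apply/setP => j; rewrite !inE; case: (boolP (j \in I)) => //= jI.
        by rewrite (subsetP sIB).
      by rewrite orbF.
    have sBF : B \subset F.
      by apply: subset_trans sBIK _; rewrite subUset sIF.
    have [||||] := cmp i (B :\: I).
    + by rewrite gE inE iNI iF.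
    + by rewrite indep_minor // BE iB andbT setSD.
    + by rewrite indep_minor // negb_and -setUA BE depB orbT.
    + by left; rewrite yu.
    move=> [j /setDP[jB jI]].
    rewrite -(yu i) // -(yu j) ?(subsetP sBF) // => yji.
    right; exists j => //; move: (subsetP sBIK j jB).
    by rewrite inE (negbTE jI).
  by right; exists j => //; rewrite yj leNye.
move=> [[ix cmp] xO].
have xI i : i \in I -> x i = +oo by move=> iI'; move: (xO i); rewrite iI'.
have xNF i : i \notin F -> x i = -oo.
  move=> iF; move: (xO i).
  by rewrite (negbTE (contra (subsetP sIF i) iF)) inE iF.
have xfin i : i \in F -> i \notin I -> (fine (x i))%:E = x i.
  by move=> iF iNI; move: (xO i); rewrite (negbTE iNI) inE iF => /fineK.
have sg0 i : i \notin F :\: I -> fine (x i) = 0%R.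
  by rewrite inE negb_and negbK => /orP[/xI|/xNF] ->.
exists (fun i => fine (x i)); last first.
  apply/funext => i; rewrite /orbit_point inE.
  have [/xI->//|iNI] := boolP (i \in I).
  have [iF|/xNF->//] := boolP (i \in F).
  by rewrite xfin.
apply/aug_bergman_supportP; rewrite gE; split=> //.
have gt0 i : 0 < (fine (x i))%:E -> i \in F :\: I /\ 0 < x i.
  have [iFI|/sg0->] := boolP (i \in F :\: I); last by rewrite ltxx.
  by move: (iFI) => /setDP[iF iNI]; rewrite xfin.
split.
  rewrite indep_minor //; apply/andP; split.
    by apply/subsetP => i; rewrite inE => /gt0[].
  apply: indepS ix; apply/subsetP => i; rewrite !inE => /orP[/gt0[]//|/xI->].
  exact: ltry.
move=> i K; rewrite gE => /setDP[iF iNI].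
rewrite !indep_minor // => /andP[sK iK].
have siFI : [set i] \subset F :\: I by rewrite sub1set inE iF iNI.
rewrite subUset siFI sK /= -setUA => dep.
have ig : i \in ground M by rewrite groundM inE.
rewrite xfin //; have [|[j]] := cmp i _ ig iK dep; first by left.
rewrite inE => /orP[jK|/xI->]; last first.
  by rewrite leye_eq => /eqP xi; move: (xO i); rewrite (negbTE iNI) inE iF xi.
move=> xji; right; exists j => //.
by have /setDP[jF jNI] := subsetP sK j jK; rewrite xfin.
Qed.

Definition closed_stratum I F : set (TP1 R E) :=
  [set x | schubert_vector M x /\
     forall i, (i \in I -> x i = +oo) /\ (i \notin F -> x i = -oo)].

Lemma stratum_sub_closed I F J G : admissible M (J, G) ->
  (I \subset J)%SET -> (G \subset F)%SET ->
  (stratum R M (J, G) `<=` closed_stratum I F)%classic.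
Proof.
move=> adm sIJ sGF x /(stratumP _ adm)[vx xO]; split=> // i.
have /and3P[_ _ /= sJG] := adm; split=> [iI|iF]; have := xO i.
  by rewrite (subsetP sIJ).
have iG : i \notin G by apply: contra iF; exact: subsetP.
by rewrite inE iG (negbTE (contra (subsetP sJG i) iG)).
Qed.

Lemma closed_closed_stratum I F : closed (closed_stratum I F).
Proof.
have -> : closed_stratum I F =
    ([set x : TP1 R E | schubert_vector M x] `&`
     (\bigcap_(i in [set` I]) [set x : TP1 R E | (+oo <= x i)%E] `&`
      \bigcap_(i in [set` (~: F)%SET])
        [set x : TP1 R E | (x i <= -oo)%E]))%classic.
  rewrite classical_sets.eqEsubset; split=> x.
    move=> [vx xIF]; split=> //; split=> i /=.
      by move/(xIF i).1 ->.
    by rewrite inE => /(xIF i).2 ->.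
  move=> [vx [xI xF]]; split=> // i; split=> [iI|iF].
    by apply/eqP; rewrite -leye_eq; exact: xI.
  by apply/eqP; rewrite -leeNy_eq; apply: xF; rewrite /= inE.
apply: closedI; first exact: closed_schubert_vector.
apply: closedI; apply: closed_bigI => i _; first exact: closed_coord_ge.
exact: closed_coord_le_cst.
Qed.

(** Truncating to [[-n, n]] the coordinates in [F :\: I] of a point of
    [closed_stratum I F] gives points of the stratum that converge to it: the
    truncation is monotone and preserves signs, and the flatness of [F] settles
    the comparisons with the coordinates outside [F], which stay at [-oo]. *)
Lemma closure_stratum I F : admissible M (I, F) ->
  closure (stratum R M (I, F)) = closed_stratum I F.
Proof.
move=> adm; rewrite classical_sets.eqEsubset; split.
  rewrite [X in (_ `<=` X)%classic](closure_id _).1;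
    last exact: closed_closed_stratum.
  exact/closureS/stratum_sub_closed.
move=> x [[ix cmp] xIF].
have /and3P[/= iI /flatP[_ extF] sIF] := adm.
have xI i : i \in I -> x i = +oo by exact: (xIF i).1.
have xNF i : i \notin F -> x i = -oo by exact: (xIF i).2.
pose y n : TP1 R E := fun i =>
  if i \in I then +oo else if i \in F then clamp n.+1 (x i) else -oo.
have yO n : tp_orbit R I (~: F)%SET (y n).
  move=> i; rewrite /y inE; case: (i \in I) => //.
  by case: (i \in F) => //=; exact: clamp_fin_num.
have yv n : schubert_vector M (y n).
  split.
    apply: indepS ix; apply/subsetP => i; rewrite !inE /y.
    have [/xI->//|iNI] := boolP (i \in I).
    by case: ifP => //; rewrite clamp_gt0.
  move=> i K ig iK dep; have [iF|iF] := boolP (i \in F); last first.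
    have /subsetPn[j jK jF] : ~~ (K \subset F).
      by apply: contra dep => sKF; apply: extF.
    right; exists j => //; rewrite /y (negbTE jF).
    by rewrite (negbTE (contra (subsetP sIF j) jF)) leNye.
  have [x_ge0|xlt0] := leP 0 (x i).
    by left; rewrite /y iF; case: ifP => _; [exact: leey|exact: clamp_ge0].
  case: (cmp i K ig iK dep) => [|[j jK xji]]; first by rewrite leNgt xlt0.
  right; exists j => //; rewrite /y iF.
  have neg_NI k : x k < 0 -> (k \in I) = false.
    by move=> xk; apply/negP => /xI xky; move: xk; rewrite xky.
  rewrite !neg_NI ?(le_lt_trans xji) //.
  by case: ifP => _; [exact: clamp_le|exact: leNye].
have cvg_coord i : (y n i @[n --> \oo] --> x i)%classic.
  rewrite /y; have [iinI|iNI] := boolP (i \in I).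
    by rewrite xI //; exact: cvg_cst.
  have [iinF|iNF] := boolP (i \in F); first exact: cvg_clamp.
  by rewrite xNF //; exact: cvg_cst.
have cvgy : (y n @[n --> \oo] --> x)%classic.
  by apply: ptws_cvg => i; exact: cvg_coord.
apply: (closed_cvg _ (@closed_closure _ _) _ x cvgy).
apply: nearW => n; apply: subset_closure.
exact/(stratumP _ adm).
Qed.

(** The fan of [M] is the stratum of the admissible pair of the empty set and
    the whole ground set, so this is a special case of [closure_stratum]. *)
Lemma schubert_varietyE :
  schubert_variety R M = [set x : TP1 R E | schubert_vector M x]%classic.
Proof.
have adm : admissible M (set0, setT).
  rewrite /admissible /= (indep0 M) sub0set andbT /=.
  by apply/flatP; rewrite groundM; split=> // i K _; rewrite inE.
have <- : closed_stratum set0 setT =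
    [set x : TP1 R E | schubert_vector M x]%classic.
  rewrite classical_sets.eqEsubset; split=> x [vx cmp]; last first.
    by split=> // i; rewrite !inE.
  exact: vx.
rewrite -closure_stratum // /schubert_variety; congr closure.
rewrite classical_sets.eqEsubset; split=> x.
  move=> [u /aug_bergman_supportP[_ vu] <-]; apply/(stratumP _ adm); split.
    suff -> : orbit_point set0 set0 u = fun i => (u i)%:E by [].
    by apply/funext => i; rewrite /orbit_point !inE.
  by move=> i; rewrite /orbit_point !inE.
move/(stratumP _ adm) => [vx xO].
have xfin i : (fine (x i))%:E = x i.
  by move: (xO i); rewrite !inE => /fineK.
exists (fun i => fine (x i)); last first.
  by apply/funext => i; rewrite /orbit_point !inE xfin.
apply/aug_bergman_supportP; split; first by move=> i; rewrite groundM inE.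
by rewrite (_ : (fun i => _) = x) //; apply/funext.
Qed.

(** The positions of the infinite coordinates of [x] determine its stratum. They
    form an admissible pair: [x i = +oo] forces [i] into the independent
    positive support, and a finite coordinate cannot bound [-oo] from below. *)
Lemma schubert_vector_stratum x : schubert_vector M x ->
  let I := [set i | x i == +oo] in let F := [set i | x i != -oo] in
  admissible M (I, F) /\ stratum R M (I, F) x.
Proof.
move=> [ix cmp] I F; have adm : admissible M (I, F).
  apply/and3P; split=> /=.
  - by apply: indepS ix; apply/subsetP => i; rewrite !inE => /eqP->.
  - apply/flatP; split; first by rewrite groundM subsetT.
    move=> i K ig; rewrite inE negbK => /eqP xi iK sKF.
    apply: contraT => dep; case: (cmp i K ig iK dep); rewrite xi //.
    move=> [j /(subsetP sKF)]; rewrite inE leeNy_eq => /negbTE-> //.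
  - by apply/subsetP => i; rewrite !inE => /eqP->.
split=> //; apply/(stratumP _ adm); split=> // i; rewrite !inE.
by case: (x i).
Qed.

Lemma stratum_inj I F x : admissible M (I, F) -> stratum R M (I, F) x ->
  I = [set i | x i == +oo] /\ F = [set i | x i != -oo].
Proof.
move=> adm /(stratumP _ adm)[_ xO]; have /and3P[_ _ /= sIF] := adm.
split; apply/setP => i; rewrite inE; move: (xO i); rewrite inE.
  case: ifP => [_ ->//|_]; case: ifP => [_ ->//|_].
  by rewrite fin_numE => /andP[_ /negbTE].
case: ifP => [/(subsetP sIF)-> ->//|_].
case: ifP => [/negbTE-> -> //|/negbFE->].
by rewrite fin_numE => /andP[].
Qed.

(** A witness is needed to read the pair [(J, G)] off an inclusion of its
    stratum in a closure. *)
Lemma stratum_nonempty I F : admissible M (I, F) ->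
  stratum R M (I, F) (orbit_point I (~: F)%SET (fun=> 0%R)).
Proof.
move=> adm; exists (fun=> 0%R) => //; apply/aug_bergman_supportP.
split=> //; split=> [|i K _ _ _]; last by left.
by apply: indepS (indep0 _); apply/subsetP => i; rewrite inE ltxx.
Qed.

Lemma stratum_leP I F J G : admissible M (I, F) -> admissible M (J, G) ->
  stratum_le (stratum R M) (J, G) (I, F) <-> (I \subset J) && (G \subset F).
Proof.
move=> admIF admJG; rewrite /stratum_le closure_stratum //; split; last first.
  by move=> /andP[sIJ sGF]; exact: stratum_sub_closed.
move=> /(_ _ (stratum_nonempty admJG))[_ xIF]; apply/andP.
split; apply/subsetP => i.
  by move=> /(xIF i).1; rewrite /orbit_point; case: ifP => //; case: ifP.
apply: contraLR => /(xIF i).2; rewrite /orbit_point inE.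
by case: ifP => //; case: (i \in G).
Qed.

Lemma locally_closed_stratum I F : admissible M (I, F) ->
  locally_closed (stratum R M (I, F)).
Proof.
move=> adm.
pose U := [set x : TP1 R E | forall i,
  (i \in I \/ (x i < +oo)%E) /\ (i \notin F \/ (-oo < x i)%E)]%classic.
exists U, (closed_stratum I F); split; last 1 first.
- rewrite classical_sets.eqEsubset; split=> x.
    move=> Sx; split; last exact: (stratum_sub_closed adm) Sx.
    move=> i; have [-> ->] := stratum_inj adm Sx; rewrite !inE negbK.
    by case: (x i); split; rewrite ?ltry ?ltNyr /=; by [left|right].
  move=> [Ux [vx xIF]]; apply/(stratumP _ adm); split=> // i.
  have [ltI gtF] := Ux i; have [eqI eqF] := xIF i.
  case: ifP => [/eqI//|iI]; rewrite inE; case: ifP => [/eqF//|/negbFE iF].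
  move: ltI gtF; rewrite iI iF => -[//|xlt] [//|xgt].
  by rewrite fin_real // xgt.
- rewrite openE => x Ux.
  apply: (@filter_forall _ E (fun i (y : TP1 R E) =>
    (i \in I \/ (y i < +oo)%E) /\ (i \notin F \/ (-oo < y i)%E))
    (nbhs x)) => i.
  have open_near (b : bool) (A : set (\bar R)) : open A -> b \/ A (x i) ->
      (\forall y \near x, b \/ A (y i))%classic.
    move=> oA [bT|Ax]; first by apply: (@filterE _ (nbhs x)) => y; left.
    have nA : nbhs (x i) A by exact: open_nbhs_nbhs.
    have : (\forall y \near x, A (y i))%classic.
      exact: (@ptws_coord_continuous R E i x A nA).
    by apply: filterS => y; right.
  have [ltI gtF] := Ux i; apply: filterI.
    apply: (open_near _ [set z | (z < +oo)%E]%classic) => //.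
    exact: open_ereal_lt_ereal.
  apply: (open_near _ [set z | (-oo < z)%E]%classic) => //.
  exact: open_ereal_gt_ereal.
- exact: closed_closed_stratum.
Qed.

End Strata.

Theorem theorem1p3 (R : realType) (E : finType) (M : matroid E)
    (groundM : ground M = [set: E]%SET) :
  stratification (schubert_variety R M) [set p | admissible M p]%classic
    (stratum R M) /\
  (forall I F J G : {set E}, admissible M (I, F) -> admissible M (J, G) ->
     (stratum_le (stratum R M) (J, G) (I, F)
      <-> (I \subset J) && (G \subset F))).
Proof.
split; last by move=> I F J G; exact: stratum_leP.
split.
- rewrite schubert_varietyE // classical_sets.eqEsubset; split=> x.
    move=> /(schubert_vector_stratum groundM)[adm Sx].
    by eexists; [exact: adm|].
  by move=> [[I F] adm] /(stratumP _ _ adm)[].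
- move=> [I F] [J G] admI admJ [x [SI SJ]].
  have [-> ->] := stratum_inj groundM admI SI.
  by have [-> ->] := stratum_inj groundM admJ SJ.
- by move=> [I F]; exact: locally_closed_stratum.
move=> [I F] adm; rewrite classical_sets.eqEsubset; split=> x; last first.
  by move=> [q [_ le_q] /le_q].
rewrite {1}closure_stratum // => -[vx xIF].
have [admx Sx] := schubert_vector_stratum groundM vx.
eexists; last exact: Sx; split=> //; apply/stratum_leP => //.
apply/andP; split; apply/fintype.subsetP => i.
  by move=> /(xIF i).1 xi; rewrite finset.inE xi.
by rewrite finset.inE; apply: contraR => /(xIF i).2 ->.
Qed.
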